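(* Let $H$ be a graph with $n$ edges and no isolated vertices, let $\epsilon>0$, and let $G$ be a graph with $N$ vertices and $\epsilon N^2$ edges such that $N \geq 100\epsilon^{-3}n$. Then $G$ contains the $1$-subdivision of $H$ as a subgraph.
   Context: The $1$-subdivision of a graph $H$ is the graph obtained from $H$ by replacing each edge by a path of length $2$, i.e., inserting one new vertex in the interior of each edge (the new vertices being distinct). Subgraph containment is not necessarily induced. *)

(* Defs.v *)
From HB Require Import structures.
From mathcomp Require Import all_boot all_order all_algebra.
Set Implicit Arguments. Unset Strict Implicit. Unset Printing Implicit Defensive.

Record sgraph := SGraph {
  vertex :> finType;
  adj : rel vertex;
  adj_sym : symmetric adj;
  adj_irrefl : irreflexive adj
}.

(* Edges are unordered, so that #|edges G| counts each edge once. *)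
Definition edges (G : sgraph) : {set {set G}} :=
  [set [set p.1; p.2] | p in [set p : G * G | adj p.1 p.2]].

Definition no_isolated (G : sgraph) : Prop :=
  forall x : G, exists y : G, adj x y.

(* Subgraph containment up to isomorphism, not necessarily induced. *)
Definition contains (G F : sgraph) : Prop :=
  exists2 f : F -> G, injective f & forall x y : F, adj x y -> adj (f x) (f y).

(* [inl x] is an original vertex; [inr e] is the new vertex placed in the
   interior of the edge e, adjacent exactly to the two endpoints of e. *)
Definition subdiv_vertex (H : sgraph) : finType := (H + {e : {set H} | e \in edges H})%type.

Definition subdiv_adj (H : sgraph) (u v : subdiv_vertex H) : bool :=
  match u, v with
  | inl x, inr e => x \in val e
  | inr e, inl x => x \in val e
  | _, _ => false
  end.

Lemma subdiv_adj_sym (H : sgraph) : symmetric (@subdiv_adj H).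
Proof. by case=> [x|e] [y|e']. Qed.

Lemma subdiv_adj_irrefl (H : sgraph) : irreflexive (@subdiv_adj H).
Proof. by case. Qed.

Definition subdivision (H : sgraph) : sgraph :=
  SGraph (@subdiv_adj_sym H) (@subdiv_adj_irrefl H).

(* Main.v *)
(* Split the vertices of G at random into S and its complement, keeping a
   quarter of the adjacent ordered pairs, and let A = N(w) :&: S for w outside
   S.  Writing d(x, y) for the number of common neighbours of x and y outside
   S, the sum over w of the weights 1/d(x, y) of the pairs in A is at most N^2,
   because each pair is counted d(x, y) times.  Convexity of the degrees then
   yields a w for which #|A| is at least 2n, hence at least #|H|, and 1/d has
   average at most 1/n over the pairs in A.  A random injection f of the
   vertices of H into A satisfies sum_(uv edge) 1/d(f u, f v) <= 1, which is
   enough to choose distinct common neighbours for the n edges greedily. *)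
Require Import Defs.
From HB Require Import structures.
From mathcomp Require Import all_boot all_order all_algebra all_fingroup.
From mathcomp Require Import lra.
Set Implicit Arguments. Unset Strict Implicit. Unset Printing Implicit Defensive.
Import Order.TTheory GRing.Theory Num.Theory.
Local Open Scope ring_scope.

(** * Averaging, distinct representatives and random injections *)

Lemma exists_le_average (R : realFieldType) (I : finType) (i0 : I)
    (F : I -> R) (c : R) :
  \sum_i F i <= #|I|%:R * c -> exists i, F i <= c.
Proof.
move=> le_avg; apply/existsP; apply: contraLR le_avg => /existsPn gt_c.
rewrite -ltNge mulr_natl -sumr_const; apply: ltr_sum => [|i _].
  by apply/hasP; exists i0; first exact: mem_index_enum.
by rewrite ltNge gt_c.
Qed.

(* Choosing last a representative of the largest set: the weight bound makes
   that set at least as large as the whole family. *)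
Lemma distinct_representatives (R : realFieldType) (E T : finType) (t0 : T)
    (D : E -> {set T}) (X : {set E}) :
    {in X, forall e, D e != set0} ->
    \sum_(e in X) (#|D e|%:R : R)^-1 <= 1 ->
  exists2 h : E -> T, {in X &, injective h} & {in X, forall e, h e \in D e}.
Proof.
have [k] := ubnP #|X|; elim: k X => // k IHk X ltXk D_neq0 le1.
have [->|[x0 x0X]] := set_0Vmem X.
  by exists (fun=> t0) => x; rewrite ?inE // => y; rewrite inE.
case: (arg_maxnP (fun e => #|D e|) x0X) => e eX' e_max; have {eX'} eX : e \in X by [].
have De_gt0 x : x \in X -> (0 < #|D x|)%N by move=> xX; rewrite card_gt0 D_neq0.
have leXD : (#|X| <= #|D e|)%N.
  rewrite -(ler_nat R) -[leRHS]mul1r -ler_pdivrMr ?ltr0n ?De_gt0 //.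
  apply: le_trans le1; rewrite mulr_natl -sumr_const.
  by apply: ler_sum => x xX; rewrite lef_pV2 ?posrE ?ltr0n ?De_gt0 // ler_nat; exact: e_max.
have XeX : X :\ e \subset X by apply: subD1set.
have [|x /(subsetP XeX)/D_neq0 //||h h_inj hD] := IHk (X :\ e).
- by move: ltXk; rewrite (cardsD1 e X) eX.
- apply: le_trans le1; rewrite [leRHS](big_setD1 e eX) /= lerDr.
  by rewrite invr_ge0 ler0n.
have [t tD tNh] : exists2 t, t \in D e & t \notin h @: (X :\ e).
  apply/subsetPn; apply/negP => /subset_leq_card.
  rewrite card_in_imset // => /(leq_trans leXD).
  by rewrite (cardsD1 e X) eX ltnn.
exists (fun x => if x == e then t else h x) => [x y xX yX /=|x xX].
  have [->|xe] := eqVneq x e; have [->|ye] := eqVneq y e => //.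
  - move=> eq_t; case/imsetP: tNh; exists y => //; by rewrite !inE ye.
  - move=> eq_t; case/imsetP: tNh; exists x => //; by rewrite !inE xe.
  - by apply: h_inj; rewrite !inE ?xe ?ye.
by case: eqVneq => [->//|xe]; apply: hD; rewrite !inE xe.
Qed.

(* The left-hand sum does not depend on the pair a <> b, since the
   permutations act transitively on such pairs; average it over all of them. *)
Lemma sum_perm_pair (R : realFieldType) (T : finType) (h : T -> T -> R)
    (a b : T) : a != b ->
  #|T|%:R * (#|T|%:R - 1) * (\sum_(s : {perm T}) h (s a) (s b)) =
  #|{perm T}|%:R * \sum_x \sum_(y | y != x) h x y.
Proof.
move=> ab.
have trans x y : y != x ->
    \sum_(s : {perm T}) h (s x) (s y) = \sum_(s : {perm T}) h (s a) (s b).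
  (* [u] sends [a] to [x]; [v] then moves the image of [b] to [y] while fixing [x]. Left
     multiplication by [u * v] thus matches the two sums. *)
  move=> yx; pose u := tperm a x; pose v := tperm (u b) y.
  have ua : u a = x by rewrite tpermL.
  have va : v x = x.
    by rewrite tpermD // -ua (inj_eq perm_inj) eq_sym.
  rewrite [RHS](reindex_inj (mulgI (u * v)%g)) /=; apply: eq_bigr => s _.
  by rewrite !permM ua va tpermL.
transitivity (\sum_x \sum_(y | y != x) \sum_(s : {perm T}) h (s x) (s y)).
  rewrite [RHS](eq_bigr (fun=> (\sum_(s : {perm T}) h (s a) (s b)) *+ #|T|.-1)).
    rewrite sumr_const -mulrnA -[RHS]mulr_natl natrM.
    have T_gt0 : (0 < #|T|)%N by apply/card_gt0P; exists a.
    by rewrite -subn1 natrB //; congr (_ * _); rewrite mulrC.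
  move=> x _; rewrite (eq_bigr _ (fun y yx => trans x y yx)) sumr_const.
  by rewrite cardC1.
under eq_bigr do rewrite exchange_big.
rewrite exchange_big /= mulr_natl -sumr_const; apply: eq_bigr => s _.
rewrite [RHS](reindex_inj (@perm_inj _ s)) /=; apply: eq_bigr => x _.
rewrite [RHS](reindex_inj (@perm_inj _ s)) /=; apply: eq_bigl => y.
by rewrite (inj_eq perm_inj).
Qed.

(** Under a uniformly random permutation of [A], the image of each edge is a uniformly random pair
    of distinct elements, so some permutation does no worse than the average. *)
Lemma exists_light_injection (R : realFieldType) (V T : finType)
    (X : {set {set V}}) (A : {set T}) (g : {set T} -> R) :
    (#|V| <= #|A|)%N -> {in X, forall e : {set V}, #|e| = 2} ->
  exists f : V -> T, [/\ injective f, forall v, f v \in A &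
    #|A|%:R * (#|A|%:R - 1) * (\sum_(e in X) g (f @: e)) <=
    #|X|%:R * \sum_(x in A) \sum_(y in A | y != x) g [set x; y]].
Proof.
move=> leVA X2.
pose f (s : {perm 'I_#|A|}) v := enum_val (s (widen_ord leVA (enum_rank v))).
have f_inj s : injective (f s).
  move=> u v /enum_val_inj/perm_inj/(congr1 val) /= /val_inj.
  exact: enum_rank_inj.
set W := \sum_(x in A) _.
have [|s le_s] := @exists_le_average R _ (1%g : {perm 'I_#|A|})
   (fun s => #|A|%:R * (#|A|%:R - 1) * (\sum_(e in X) g (f s @: e))) (#|X|%:R * W).
  rewrite -mulr_sumr exchange_big /= mulr_sumr [leRHS]mulrCA [leRHS]mulr_natl -[leRHS]sumr_const.
  apply: ler_sum => e eX; have /eqP/cards2P[u [v [uv ->]]] := X2 e eX.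
  under eq_bigr do rewrite imsetU1 imset_set1.
  have := @sum_perm_pair R _
    (fun x y : 'I_#|A| => g [set enum_val x; enum_val y])
    (widen_ord leVA (enum_rank u)) (widen_ord leVA (enum_rank v)).
  rewrite card_ord /f => ->; last first.
    by apply: contraNneq uv => /(congr1 val)/= /ord_inj/enum_rank_inj ->.
  apply: ler_wpM2l; first exact: ler0n.
  rewrite /W [leRHS]big_enum_val; apply: ler_sum => x _.
  rewrite [leRHS]big_enum_val_cond /= le_eqVlt; apply/orP; left; apply/eqP.
  by apply: eq_bigl => y; rewrite (inj_eq enum_val_inj).
by exists (f s); split=> // v; apply: enum_valP.
Qed.

(** * Random bipartitions *)

Lemma card_separating_sets (T : finType) (x y : T) : x != y ->
  (4 * #|[set S : {set T} | (x \in S) && (y \notin S)]|)%N = #|{set T}|.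
Proof.
(* Such an [S] is [x] added to an arbitrary subset of the complement of [[set x; y]]. *)
move=> xy; have -> : [set S : {set T} | (x \in S) && (y \notin S)] =
    [set x |: S | S in powerset (~: [set x; y])].
  apply/setP=> S; rewrite inE; apply/andP/imsetP => [[xS yS]|[S' + ->]].
    exists (S :\ x); last by rewrite setD1K.
    rewrite powersetE; apply/subsetP => z; rewrite !inE negb_or.
    by case/andP=> -> zS; apply: contraNneq yS => <-.
  rewrite powersetE !inE eqxx => /subsetP S'P.
  rewrite negb_or eq_sym xy; split=> //.
  by apply/negP => /S'P; rewrite !inE eqxx orbT.
rewrite card_in_imset => [|S S' /[!powersetE] /subsetP SP /subsetP S'P eqS].
  have := cardsC [set x; y]; rewrite cards2 xy => cardT.
  by rewrite card_powerset -[RHS]cardsT -powersetT card_powerset cardsT -cardT expnD.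
apply/setP => z; have [->|zx] := eqVneq z x.
  have xN (B : {set T}) : (forall t, t \in B -> t \in ~: [set x; y]) -> (x \in B) = false.
    by move=> BP; apply/negbTE/negP => /BP; rewrite !inE eqxx.
  by rewrite !xN.
by move/setP/(_ z): eqS; rewrite !inE (negbTE zx).
Qed.

(* A uniformly random [S] separates each related pair, in the right direction,
   with probability 1/4. *)
Lemma exists_cut (R : realFieldType) (T : finType) (e : rel T) :
    irreflexive e ->
  exists S : {set T}, #|[set p : T * T | e p.1 p.2]|%:R <=
    4%:R * \sum_(w | w \notin S) #|[set x in S | e w x]|%:R :> R.
Proof.
move=> e_irr; set P := [set p | _].
pose cut (S : {set T}) : R := \sum_(w | w \notin S) #|[set x in S | e w x]|%:R.
(* Negation turns the averaging lemma into a lower bound. *)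
have [|S leS] := @exists_le_average R _ (set0 : {set T})
    (fun S => - (4%:R * cut S)) (- #|P|%:R); last first.
  by exists S; move: leS; rewrite lerN2.
rewrite sumrN mulrN lerN2 -mulr_sumr.
have cutE S : cut S = \sum_(p in P) ((p.2 \in S) && (p.1 \notin S))%:R.
  rewrite /cut big_mkcond [RHS]big_mkcond /=.
  under [RHS]eq_bigr do rewrite inE.
  rewrite -(pair_bigA _ (fun w x => if e w x then
    ((x \in S) && (w \notin S))%:R else 0)) /=.
  apply: eq_bigr => w _; case: ifP => wS.
    rewrite -sum1_card natr_sum big_mkcond; apply: eq_bigr => x _.
    by rewrite !inE /= andbT; case: (x \in S); case: (e w x).
  by rewrite big1 // => x _; rewrite andbF if_same.
rewrite (eq_bigr _ (fun S _ => cutE S)) exchange_big /= mulr_sumr mulr_natr -[leLHS]sumr_const.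
apply: ler_sum => -[w x]; rewrite inE /= => ewx.
have xw : x != w by apply: contraTneq ewx => ->; rewrite e_irr.
rewrite -(card_separating_sets xw) natrM ler_wpM2l ?ler0n //.
by rewrite -sumr_const big_mkcond /=; apply: ler_sum => S _; rewrite inE; case: ifP.
Qed.

(** * Degrees and common neighbourhoods in a bipartite relation *)

Section Neighborhoods.
Variables (R : realFieldType) (U T : finType) (r : U -> T -> bool).

Definition nbhd (w : U) : {set T} := [set x | r w x].
Definition common_nbhd (B : {set T}) : {set U} := [set w | B \subset nbhd w].
(** Pairs are ordered. The denominators are positive, since [w] is itself a common neighbour. *)
Definition pair_weight (w : U) : R :=
  \sum_(x in nbhd w) \sum_(y in nbhd w | y != x)
    #|common_nbhd [set x; y]|%:R^-1.

Lemma sum_pair_weight : \sum_w pair_weight w <= #|T|%:R ^+ 2.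
Proof.
rewrite /pair_weight; under eq_bigr do rewrite big_mkcond /=.
rewrite exchange_big /= expr2 mulr_natl -sumr_const.
apply: ler_sum => x _; rewrite -sumr_const.
rewrite -big_mkcond /=; under eq_bigr do rewrite big_mkcondr big_mkcond /=.
rewrite exchange_big /=; apply: ler_sum => y _.
apply: (@le_trans _ _ (\sum_(w in common_nbhd [set x; y])
    (#|common_nbhd [set x; y]|%:R : R)^-1)).
  rewrite big_mkcond [leRHS]big_mkcond; apply: ler_sum => w _.
  rewrite [w \in common_nbhd _]inE subUset !sub1set.
  by do 3?case: ifP => //=; rewrite invr_ge0 ler0n.
rewrite sumr_const -[leLHS]mulr_natr.
have [->|/negbTE C_neq0] := eqVneq #|common_nbhd [set x; y]| 0%N.
  by rewrite mulr0 ler01.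
by rewrite mulVf // pnatr_eq0 C_neq0.
Qed.

(* Bounding [a ^+ 2] below by its tangent [2 * c * a - c ^+ 2] replaces the
   Cauchy-Schwarz inequality for the degrees [a]. *)
Lemma exists_rich_vertex (n : nat) (c : R) : 0 <= c ->
    c * #|U|%:R <= \sum_w #|nbhd w|%:R ->
    #|T|%:R * #|U|%:R + n%:R * #|T|%:R ^+ 2 + 4%:R * n%:R ^+ 2 * #|U|%:R
      < c ^+ 2 * #|U|%:R ->
  exists2 w, (2 * n <= #|nbhd w|)%N &
    n%:R * pair_weight w <= #|nbhd w|%:R * (#|nbhd w|%:R - 1).
Proof.
move=> c_ge0 le_deg lt_c.
(* With [a] the degree of [w], [F w < 0] and the tangent bound give [n * pair_weight w + 4 * n ^ 2 +
   a < a ^ 2], which contains both conclusions. *)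
pose F w := n%:R * pair_weight w + 4%:R * n%:R ^+ 2 + #|nbhd w|%:R
            + c ^+ 2 - 2%:R * c * #|nbhd w|%:R.
have [w Fw] : exists w, F w < 0.
  apply/existsP; have : \sum_w F w < 0.
    rewrite /F sumrB !big_split /= -!mulr_sumr !sumr_const.
    rewrite -(mulr_natr (n%:R)) -(mulr_natr c) -[#|xpredT|]/#|U|.
    have := ler_wpM2l (ler0n R n) sum_pair_weight.
    have : \sum_w (#|nbhd w|%:R : R) <= #|T|%:R * #|U|%:R.
      rewrite mulr_natr -sumr_const.
      by apply: ler_sum => w _; rewrite ler_nat max_card.
    have := ler_wpM2l c_ge0 le_deg.
    move: (\sum_w pair_weight w) (\sum_w _) => W a. lra.
  apply: contraTT => /existsPn F_ge0; rewrite -leNgt sumr_ge0 // => w _.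
  by rewrite leNgt.
have W_ge0 : 0 <= pair_weight w.
  by rewrite sumr_ge0 // => x _; rewrite sumr_ge0 // => y _; rewrite invr_ge0.
have tangent := sqr_ge0 (#|nbhd w|%:R - c); have n2_ge0 := sqr_ge0 (n%:R : R).
have nW_ge0 := mulr_ge0 (ler0n R n) W_ge0.
rewrite /F in Fw; exists w; last by lra.
rewrite -(ler_nat R) natrM -(ler_pXn2r (ltn0Sn 1)) ?nnegrE ?mulr_ge0 ?ler0n //.
have := ler0n R #|nbhd w|. lra.
Qed.

End Neighborhoods.

(** * Application to graphs *)

Lemma card_edge (H : sgraph) : {in edges H, forall e : {set H}, #|e| = 2}.
Proof.
move=> _ /imsetP[[x y] + ->]; rewrite inE /= => xy; rewrite cards2.
by rewrite (contraTneq _ xy) // => ->; rewrite adj_irrefl.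
Qed.

Lemma card_vertex_le (H : sgraph) : no_isolated H -> (#|H| <= 2 * #|edges H|)%N.
Proof.
move=> no_iso; rewrite mulnC -sum_nat_const -(eq_bigr _ (@card_edge H)).
apply: leq_trans (leq_card_cover (edges H)); apply/subset_leq_card/subsetP => x _.
have [y xy] := no_iso x; apply/bigcupP; exists [set x; y]; last by rewrite !inE eqxx.
by apply/imsetP; exists (x, y); rewrite ?inE.
Qed.

(** From [eps <= 1] follows [100 * n <= eps ^ 2 * N <= N]. So the left side is at most
    [2.04 * n * N ^ 2], and the right side at least [6.25 * n * N ^ 2]. *)
Lemma large_order_bound (R : realFieldType) (eps N n : R) :
    0 < eps -> 1 <= n -> eps * N ^+ 2 <= N ^+ 2 -> 100%:R * eps ^- 3 * n <= N ->
  N * N + n * N ^+ 2 + 4%:R * n ^+ 2 * N < (eps * N / 4%:R) ^+ 2 * N.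
Proof.
move=> eps_gt0 n_ge1 le_epsN le_N.
have e3_gt0 : 0 < eps ^+ 3 by rewrite exprn_gt0.
have N_gt0 : 0 < N.
  apply: lt_le_trans le_N; rewrite !mulr_gt0 ?invr_gt0 //; lra.
have eps_le1 : eps <= 1.
  by move: le_epsN; rewrite -[leRHS]mul1r ler_pM2r // exprn_gt0.
have le_e3N : 100%:R * n <= eps ^+ 3 * N.
  by move: le_N; rewrite mulrAC ler_pdivrMr // mulrC [N * _]mulrC.
have le_e2N : eps ^+ 3 * N <= eps ^+ 2 * N.
  by rewrite ler_pM2r // exprS ler_piMl // exprn_ge0 // ltW.
have le_eN : eps ^+ 2 * N <= N.
  by rewrite -[leRHS]mul1r ler_pM2r // exprn_ile1 // ltW.
have lt_half : N + n * N + 4%:R * n ^+ 2 < eps ^+ 2 * N * N / 16%:R.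
  have : 100%:R * n * N <= eps ^+ 2 * N * N by rewrite ler_pM2r //; lra.
  have : N <= n * N by rewrite -[leLHS]mul1r ler_pM2r.
  have : 100%:R * n ^+ 2 <= n * N by rewrite expr2 mulrCA ler_pM2l; lra.
  lra.
have := ltr_pM2r N_gt0 (N + n * N + 4%:R * n ^+ 2) (eps ^+ 2 * N * N / 16%:R).
rewrite lt_half; lra.
Qed.

Theorem theorem1p7 (R : realFieldType) (H G : sgraph) (n N : nat) (eps : R)
    (H_edges : #|edges H| = n) (H_no_isolated : no_isolated H)
    (eps_gt0 : 0 < eps)
    (G_order : #|G| = N) (G_edges : #|edges G|%:R = eps * N%:R ^+ 2)
    (N_large : N%:R >= 100%:R * eps ^- 3 * n%:R) :
  contains G (subdivision H).
Proof.
have leHn := card_vertex_le H_no_isolated; rewrite H_edges in leHn.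
have [n0|n_gt0] := posnP n.
  have noH : forall x : H, False.
    move=> x; have : (0 < #|H|)%N by apply/card_gt0P; exists x.
    by rewrite ltnNge (leq_trans leHn) // n0.
  have no_sub : forall u : subdivision H, False.
    case=> [//|[e eH]]; have /eqP/cards2P[x _] := card_edge eH; exact: noH x.
  by exists (fun u => False_rect G (no_sub u)) => u; case: (no_sub u).
have [S leS] := exists_cut R (@adj_irrefl G).
(* Only arcs from outside [S] into [S] are kept: original vertices will land in [S] and subdividing
   ones outside, so their images cannot collide. *)
pose r (w x : G) := [&& w \notin S, x \in S & adj w x].
have le_arcs : (#|edges G| <= #|[set p : G * G | adj p.1 p.2]|)%N.
  exact: leq_imset_card.
have deg_sum : eps * N%:R / 4%:R * #|G|%:R <= \sum_w #|nbhd r w|%:R.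
  have : \sum_(w | w \notin S) #|[set x in S | adj w x]|%:R
       <= \sum_w #|nbhd r w|%:R :> R.
    rewrite big_mkcond; apply: ler_sum => w _; case: ifP => wS //.
    rewrite ler_nat subset_leq_card //; apply/subsetP => x.
    by rewrite !inE /r wS.
  by rewrite -(ler_nat R) G_edges in le_arcs; rewrite G_order; lra.
have [||w le_w light_w] := @exists_rich_vertex R _ _ r n _ _ deg_sum.
- by rewrite !mulr_ge0 ?invr_ge0 ?ler0n ?ltW.
- rewrite G_order; apply: large_order_bound => //; first by rewrite ler1n.
  rewrite -G_edges -natrX ler_nat (leq_trans le_arcs) //.
  by rewrite (leq_trans (max_card _)) // card_prod G_order mulnn.
have [f [f_inj fA le_f]] := exists_light_injection
  (fun B : {set G} => (#|common_nbhd r B|%:R : R)^-1)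
  (leq_trans leHn le_w) (@card_edge H).
have a_gt1 : (1 < #|nbhd r w|)%N by apply: leq_trans le_w; rewrite leq_pmulr.
(* Chaining [le_f] with [light_w] and cancelling the factor [a * (a - 1)], positive by [a_gt1],
   where [a] is the degree of [w]. *)
have weight_le1 : \sum_(e in edges H) (#|common_nbhd r (f @: e)|%:R : R)^-1 <= 1.
  rewrite H_edges in le_f; have := le_trans le_f light_w.
  by rewrite ger_pMr // mulr_gt0 ?subr_gt0 ?ltr0n ?ltr1n // ltnW.
(* As [f] maps into [nbhd r w], the vertex [w] is a common neighbour for every edge, so no candidate
   set is empty. *)
have [e eH|h h_inj hP] := distinct_representatives w _ weight_le1.
  apply/set0Pn; exists w; rewrite inE; apply/subsetP => _ /imsetP[x _ ->].
  exact: fA.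
have rh (e : {e : {set H} | e \in edges H}) x : x \in val e ->
    [/\ h (val e) \notin S, f x \in S & adj (h (val e)) (f x)].
  move=> xe; have := hP _ (valP e); rewrite inE => /subsetP/(_ _ (imset_f f xe)).
  by rewrite inE => /and3P.
have fS x : f x \in S by have := fA x; rewrite inE => /and3P[].
have hS (e : {e : {set H} | e \in edges H}) : h (val e) \notin S.
  have /eqP/cards2P[x [y [_ def_e]]] := card_edge (valP e).
  by case: (rh e x _); rewrite // def_e !inE eqxx.
exists (fun u : subdivision H =>
  match u with inl x => f x | inr e => h (val e) end).
- move=> [x|e] [y|e'] /= eq_uv.
  + by rewrite (f_inj _ _ eq_uv).
  + by have := hS e'; rewrite -eq_uv fS.
  + by have := hS e; rewrite eq_uv fS.
  + by congr inr; apply/val_inj/h_inj; rewrite ?(valP e) ?(valP e').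
- move=> [x|e] [y|e'] //= /rh[_ _ //].
  by rewrite adj_sym.
Qed.
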